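(* Let $\Delta$ be a finite chamber complex, and for each chamber $C$ define the relation $\le_C$ on chambers by: $D\le_C E$ iff there is a geodesic gallery from $C$ to $E$ passing through $D$. Then the following are equivalent: (a) $\Delta$ has the gate property; (b) the partial orders $\le_C$ ($C$ a chamber) satisfy the shelling axioms (S1)–(S3); (c) for every face $F$ and chamber $C$ there is a unique chamber $FC$ containing $F$ at minimal gallery distance from $C$, and the resulting map $(F,C)\mapsto FC$ satisfies the projection axioms (P1)–(P3). Moreover, when these hold, the maps $R_C$, where $R_C(D)$ is the face of $D$ spanned by the vertices $v$ of $D$ with $(D\setminus v)C\ne D$, satisfy the restriction axioms (R1)–(R3).
   Context: A chamber complex is a finite pure simplicial complex (chambers = maximal faces) that is gallery connected: two chambers are adjacent if they share a codimension-one face, a gallery is a sequence of chambers with consecutive ones adjacent, and any two chambers are joined by a gallery. The gallery distance $d(C,D)$ is the minimal length of a gallery from $C$ to $D$; a gallery achieving it is geodesic. Gate property: for every face $F$ and chamber $C$ there is a chamber $D\supseteq F$ with $d(C,E)=d(C,D)+d(D,E)$ for every chamber $E\supseteq F$. $D\setminus v$ is the codimension-one face of $D$ not containing the vertex $v$. $\mathcal{F}$ denotes the faces (including $\emptyset$), $\mathcal{C}$ the chambers, $\le$ the face relation, $G\lessdot D$ a codimension-one face, $\mathcal{C}_{\ge F}$ the chambers containing $F$; a shelling is a linear order on chambers such that each chamber other than the first meets the union of the earlier ones in a nonempty union of its codimension-one faces. Axioms: (P1)(i) $FC=D\Rightarrow F\le D$; (ii) $F\le C\Rightarrow FC=C$;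 (iii) $FC=D$, $F\le G\le D\Rightarrow GC=D$. (P2) if $F\le D$ and $GC=D$ for all $F\le G\lessdot D$ then $FC=D$. (P3) if $FC=D$ and $C_1,\dots,C_n=D$ is a weak $C$-gallery (faces $F_i$ with $F_iC=C_i$, $F_i\le C_i,C_{i+1}$) then $FC_1=D$. (R1) $R_C(C)=\emptyset$, $R_C(D)\le D$; (R2) for each $C$, $\mathcal{F}=\bigsqcup_{D}\{F: R_C(D)\le F\le D\}$; (R3) if $R_C(C_i)\le C_{i+1}$ for $1\le i<n$ and $C_n=D$ then $R_{C_1}(D)\le R_C(D)\le D$. (S1) for each $F$, $\le_C$ restricted to $\mathcal{C}_{\ge F}$ has a unique minimal element, equal to $C$ when $F=\emptyset$; (S2) every linear extension of $\le_C$ is a shelling of $\Delta$; (S3) $D\le_C D_1\le_C D_2\Rightarrow D_1\le_D D_2$. *)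

(* Defs.v *)
From mathcomp Require Import all_boot.

Set Implicit Arguments.
Unset Strict Implicit.
Unset Printing Implicit Defensive.

(* A complex is its set of faces, the empty face included.  The ambient type
   [V] may contain elements that are not vertices of the complex. *)

Definition is_complex (V : finType) (K : {set {set V}}) : Prop :=
  set0 \in K /\ forall F G : {set V}, F \in K -> G \subset F -> G \in K.

Definition chambers (V : finType) (K : {set {set V}}) : {set {set V}} :=
  [set C | maxset (fun F : {set V} => F \in K) C].

Definition star (V : finType) (K : {set {set V}}) (F : {set V}) :
    {set {set V}} :=
  [set C in chambers K | F \subset C].

Definition pure (V : finType) (K : {set {set V}}) : Prop :=
  {in chambers K &, forall C D : {set V}, #|C| = #|D|}.

Definition codim1 (V : finType) (G D : {set V}) : bool :=
  (G \subset D) && (#|D| == #|G|.+1).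

Definition adjacent (V : finType) (K : {set {set V}}) : rel {set V} :=
  fun C D => [&& C \in chambers K, D \in chambers K &
              [exists G : {set V}, codim1 G C && codim1 G D]].

(* The gallery C, p_1, ..., p_n is given by its first chamber [C] and the
   sequence [p] of the others, so that its length is [size p]. *)
Definition gallery (V : finType) (K : {set {set V}}) (C : {set V})
    (p : seq {set V}) : bool :=
  (C \in chambers K) && path (adjacent K) C p.

Definition chamber_complex (V : finType) (K : {set {set V}}) : Prop :=
  [/\ is_complex K, pure K &
      {in chambers K &, forall C D : {set V},
        exists2 p : seq {set V}, gallery K C p & last C p = D}].

(* The search stops below the number of chambers because a shortest gallery
   does not repeat a chamber; see [distP]. *)
Definition dist (V : finType) (K : {set {set V}}) (C D : {set V}) : nat :=
  find (fun n => [exists p : n.-tuple {set V},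
                    gallery K C p && (last C p == D)])
       (iota 0 #|chambers K|).

Lemma distP (V : finType) (K : {set {set V}}) (C D : {set V}) :
  chamber_complex K -> C \in chambers K -> D \in chambers K ->
  (exists2 p, gallery K C p & last C p = D /\ size p = dist K C D) /\
  (forall p, gallery K C p -> last C p = D -> dist K C D <= size p).
Proof.
case=> _ _ conn Cc Dc.
pose a n := [exists p : n.-tuple {set V}, gallery K C p && (last C p == D)].
have aI p : gallery K C p -> last C p = D -> a (size p).
  by move=> gp lp; apply/existsP; exists (in_tuple p); rewrite gp lp eqxx.
have short p : gallery K C p -> last C p = D ->
    exists2 q, gallery K C q &
      [/\ last C q = D, size q <= size p & size q < #|chambers K|].
  case/andP=> _ pp; case/shortenP: pp => q pq uq sq lq.
  have qc : {subset C :: q <= chambers K}.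
    move=> x; rewrite inE => /predU1P[-> //|].
    elim: q {uq sq lq} C pq {Cc aI a} => //= y q IH z /andP[/and3P[_ yc _] pq].
    by rewrite inE => /predU1P[->|/(IH _ pq)].
  exists q; first by rewrite /gallery Cc.
  split=> //.
    by apply: uniq_leq_size => //; case/andP: uq.
  by rewrite cardE (uniq_leq_size uq) // => x /qc; rewrite mem_enum.
have has_a : has a (iota 0 #|chambers K|).
  have [p gp lp] := conn _ _ Cc Dc.
  have [q gq [lq _ sq]] := short _ gp lp.
  by apply/hasP; exists (size q); rewrite ?mem_iota ?aI.
have lt_d : dist K C D < #|chambers K|.
  by have := has_a; rewrite has_find size_iota.
split.
  have := nth_find 0 has_a.
  rewrite (nth_iota 0 0 lt_d) add0n => /existsP[p /andP[gp /eqP lp]].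
  by exists p => //; split=> //; rewrite size_tuple.
move=> p gp lp; have [q gq [lq qp sq]] := short _ gp lp.
apply: leq_trans qp; rewrite leqNgt; apply/negP => lt_q.
have := before_find 0 lt_q; rewrite (nth_iota 0 0 sq) add0n.
by move: (aI _ gq lq); rewrite /a => ->.
Qed.

Definition geodesic (V : finType) (K : {set {set V}}) (C : {set V})
    (p : seq {set V}) : bool :=
  gallery K C p && (size p == dist K C (last C p)).

Definition gate_property (V : finType) (K : {set {set V}}) : Prop :=
  forall F C : {set V}, F \in K -> C \in chambers K ->
  exists2 D : {set V}, D \in star K F &
    forall E : {set V}, E \in star K F ->
      dist K C E = dist K C D + dist K D E.

(* [gallery_le K C D E] is D <=_C E; the length of the tuple is no
   restriction, since a geodesic gallery from C to E has length dist K C E. *)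
Definition gallery_le (V : finType) (K : {set {set V}}) (C : {set V}) :
    rel {set V} :=
  fun D E => [exists p : (dist K C E).-tuple {set V},
                [&& geodesic K C p, last C p == E & D \in C :: p]].

Definition partial_order_on (T : finType) (A : {set T}) (r : rel T) : Prop :=
  [/\ {in A, reflexive r}, {in A &, antisymmetric r} &
      {in A & &, transitive r}].

Definition linear_order_on (T : finType) (A : {set T}) (r : rel T) : Prop :=
  partial_order_on A r /\ {in A &, total r}.

Definition linear_extension (T : finType) (A : {set T}) (r s : rel T) : Prop :=
  linear_order_on A s /\ {in A &, forall x y, r x y -> s x y}.

Definition minimal_in (T : finType) (A : {set T}) (r : rel T) (x : T) : Prop :=
  x \in A /\ forall y, y \in A -> r y x -> y = x.

Definition earlier (V : finType) (K : {set {set V}}) (s : rel {set V})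
    (E : {set V}) : {set {set V}} :=
  [set D in chambers K | (D != E) && s D E].

(* Subcomplexes are compared as sets of faces: [powerset D] is the set of all
   faces of the simplex D. *)
Definition shelling (V : finType) (K : {set {set V}}) (s : rel {set V}) :
    Prop :=
  linear_order_on (chambers K) s /\
  forall E : {set V}, E \in chambers K -> earlier K s E != set0 ->
  exists S : {set {set V}},
    [/\ S != set0,
        {in S, forall G : {set V}, codim1 G E} &
        powerset E :&: (\bigcup_(D in earlier K s E) powerset D) =
        \bigcup_(G in S) powerset G].

Record shelling_axioms (V : finType) (K : {set {set V}})
    (le : {set V} -> rel {set V}) : Prop := ShellingAxioms {
  shelling_S1 : forall C F : {set V}, C \in chambers K -> F \in K ->
    exists2 D : {set V}, unique (minimal_in (star K F) (le C)) D &
      (F = set0 -> D = C);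
  shelling_S2 : forall (C : {set V}) (s : rel {set V}), C \in chambers K ->
    linear_extension (chambers K) (le C) s -> shelling K s;
  shelling_S3 : forall C D D1 D2 : {set V},
    C \in chambers K -> D \in chambers K ->
    D1 \in chambers K -> D2 \in chambers K ->
    le C D D1 -> le C D1 D2 -> le D D1 D2
}.

Definition nearest (V : finType) (K : {set {set V}}) (F C D : {set V}) : bool :=
  (D \in star K F) && [forall E in star K F, dist K C D <= dist K C E].

(* Meaningful only when the nearest chamber is unique. *)
Definition proj (V : finType) (K : {set {set V}}) (F C : {set V}) : {set V} :=
  odflt set0 [pick D | nearest K F C D].

(* The weak C-gallery C_1, s is given by its first chamber and the sequence of
   the others; the faces F_i are quantified step by step. *)
Definition weak_gallery (V : finType) (K : {set {set V}})
    (p : {set V} -> {set V} -> {set V}) (C C1 : {set V}) (s : seq {set V}) :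
    bool :=
  all (fun X => X \in chambers K) (C1 :: s) &&
  path (fun X Y => [exists G in K,
          [&& p G C == X, G \subset X & G \subset Y]]) C1 s.

Record projection_axioms (V : finType) (K : {set {set V}})
    (p : {set V} -> {set V} -> {set V}) : Prop := ProjectionAxioms {
  projection_P1i : forall F C D : {set V},
    F \in K -> C \in chambers K -> D \in chambers K ->
    p F C = D -> F \subset D;
  projection_P1ii : forall F C : {set V},
    F \in K -> C \in chambers K -> F \subset C -> p F C = C;
  projection_P1iii : forall F G C D : {set V},
    F \in K -> G \in K -> C \in chambers K -> D \in chambers K ->
    p F C = D -> F \subset G -> G \subset D -> p G C = D;
  projection_P2 : forall F C D : {set V},
    F \in K -> C \in chambers K -> D \in chambers K ->
    F \subset D ->
    (forall G : {set V}, F \subset G -> codim1 G D -> p G C = D) ->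
    p F C = D;
  projection_P3 : forall (F C D C1 : {set V}) (s : seq {set V}),
    F \in K -> C \in chambers K -> D \in chambers K ->
    p F C = D -> weak_gallery K p C C1 s -> last C1 s = D -> p F C1 = D
}.

Definition nearest_projection (V : finType) (K : {set {set V}}) : Prop :=
  (forall F C : {set V}, F \in K -> C \in chambers K ->
     exists! D : {set V}, nearest K F C D) /\
  projection_axioms K (proj K).

(* [restriction K C D] is R_C(D). *)
Definition restriction (V : finType) (K : {set {set V}}) (C D : {set V}) :
    {set V} :=
  [set v in D | proj K (D :\ v) C != D].

Record restriction_axioms (V : finType) (K : {set {set V}})
    (R : {set V} -> {set V} -> {set V}) : Prop := RestrictionAxioms {
  restriction_R1_self : forall C : {set V}, C \in chambers K -> R C C = set0;
  restriction_R1_sub : forall C D : {set V},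
    C \in chambers K -> D \in chambers K -> R C D \subset D;
  restriction_R2_cover : forall C : {set V}, C \in chambers K ->
    K = \bigcup_(D in chambers K)
          [set F : {set V} | (R C D \subset F) && (F \subset D)];
  restriction_R2_disjoint : forall C D E : {set V},
    C \in chambers K -> D \in chambers K -> E \in chambers K -> D != E ->
    [disjoint [set F : {set V} | (R C D \subset F) && (F \subset D)] &
              [set F : {set V} | (R C E \subset F) && (F \subset E)]];
  restriction_R3 : forall (C D C1 : {set V}) (s : seq {set V}),
    C \in chambers K -> all (fun X => X \in chambers K) (C1 :: s) ->
    path (fun X Y : {set V} => R C X \subset Y) C1 s -> last C1 s = D ->
    R C1 D \subset R C D /\ R C D \subset D
}.

(* Main.v *)
Require Import Defs.
From mathcomp Require Import all_boot.
From mathcomp Require Import zify.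

(** In metric terms [D <=_C E] says [d(C,E) = d(C,D) + d(D,E)], so the gate
    property says that [<=_C] has a least element [FC] on the star of [F], and
    (S3), (P3) are consequences of the triangle inequality.  Under the gate
    property stars are geodesically convex: if [X] lies between two chambers of
    the star of [F], its gate does so too, at no loss of length, hence equals
    [X].  So a geodesic from [FC] to [E] stays in the star of [F], and if
    [FC != E] its last step crosses a codimension-one face [G] of [E] with
    [F <= G] and [GC != E].  This is (P2); it also yields the shellings.
    Conversely (P2) lets one descend from [E] to [FC] inside the star of [F]
    through adjacent chambers, decreasing the distance to [C] by one each time,
    whence [FC <=_C E]. *)

Set Implicit Arguments.
Unset Strict Implicit.
Unset Printing Implicit Defensive.

Section GateProperty.

Variables (V : finType) (K : {set {set V}}).
Hypothesis hK : chamber_complex K.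

Implicit Types (C D E X F G : {set V}) (p s : seq {set V}).

Local Notation ch := (chambers K).
Local Notation dist := (dist K).
Local Notation star := (star K).
Local Notation le := (gallery_le K).
Local Notation proj := (proj K).

(** * Faces, chambers and the gallery metric *)

Lemma face_sub F G : F \in K -> G \subset F -> G \in K.
Proof. by case: hK => -[_ h] _ _; apply: h. Qed.

Lemma set0_face : set0 \in K.
Proof. by case: hK => -[]. Qed.

Lemma chamber_face C : C \in ch -> C \in K.
Proof. by rewrite inE => /maxsetP[]. Qed.

Lemma chamber_sub C F : C \in ch -> F \subset C -> F \in K.
Proof. by move=> /chamber_face; apply: face_sub. Qed.

Lemma in_star F C : (C \in star F) = (C \in ch) && (F \subset C).
Proof. by rewrite !inE. Qed.

Lemma star_chamber F C : C \in star F -> C \in ch.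
Proof. by rewrite in_star => /andP[]. Qed.

Lemma adjacent_sym : symmetric (adjacent K).
Proof.
move=> C D; rewrite /adjacent andbCA; congr [&& _, _ & _].
by apply: eq_existsb => G; rewrite andbC.
Qed.

Lemma gallery_last C p : gallery K C p -> last C p \in ch.
Proof.
case/andP; case/lastP: p => // p X _.
by rewrite rcons_path last_rcons => /andP[_ /and3P[]].
Qed.

Lemma gallery_cat C p s :
  gallery K C (p ++ s) = gallery K C p && gallery K (last C p) s.
Proof.
rewrite /gallery cat_path andbA; case: (boolP (gallery K C p)) => [gp|].
  by move: (gp); rewrite /gallery (gallery_last gp) => ->.
by rewrite /gallery => /negPf ->.
Qed.

Lemma dist_gallery C p : gallery K C p -> dist C (last C p) <= size p.
Proof.
move=> gp; have Cc : C \in ch by case/andP: gp.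
by have [_ ->] := distP hK Cc (gallery_last gp).
Qed.

Lemma shortest C D : C \in ch -> D \in ch ->
  exists p, [/\ gallery K C p, last C p = D & size p = dist C D].
Proof.
by move=> Cc Dc; have [[p gp [lp sp]] _] := distP hK Cc Dc; exists p.
Qed.

Lemma dist_refl C : C \in ch -> dist C C = 0.
Proof.
move=> Cc; apply/eqP; rewrite -leqn0.
by apply: (@dist_gallery C [::]); rewrite /gallery Cc.
Qed.

Lemma dist_eq0 C D : C \in ch -> D \in ch -> dist C D = 0 -> C = D.
Proof.
by move=> Cc Dc d0; have [[|X p] [_ lp]] := shortest Cc Dc; rewrite ?d0.
Qed.

Lemma dist_triangle C D E : C \in ch -> D \in ch -> E \in ch ->
  dist C E <= dist C D + dist D E.
Proof.
move=> Cc Dc Ec; have [p [gp lp <-]] := shortest Cc Dc.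
have [q [gq <- <-]] := shortest Dc Ec.
by rewrite -size_cat -lp -last_cat dist_gallery // gallery_cat gp lp.
Qed.

Lemma dist_sym_le C D : C \in ch -> D \in ch -> dist D C <= dist C D.
Proof.
move=> Cc Dc; have [p [/andP[_ gp] lp <-]] := shortest Cc Dc.
(* A gallery omits its first chamber, so the reversal drops [D] and ends with [C]. *)
have gr : gallery K D (rev (belast C p)).
  rewrite /gallery Dc -lp rev_path /=.
  by rewrite (eq_path (fun X Y => adjacent_sym Y X)).
have lr : last D (rev (belast C p)) = C.
  by case: p {gp gr} lp => [//|X p] _; rewrite /= rev_cons last_rcons.
by have := dist_gallery gr; rewrite lr size_rev size_belast.
Qed.

Lemma dist_sym C D : C \in ch -> D \in ch -> dist C D = dist D C.
Proof. by move=> Cc Dc; apply/eqP; rewrite eqn_leq !dist_sym_le. Qed.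

Lemma dist_adjacent C D : adjacent K C D -> dist C D <= 1.
Proof.
move=> aCD; apply: (@dist_gallery C [:: D]).
by rewrite /gallery /= aCD; case/and3P: aCD => ->.
Qed.

(** * The orders [<=_C] as metric betweenness *)

Lemma gallery_leP C D E : C \in ch -> D \in ch -> E \in ch ->
  reflect (dist C E = dist C D + dist D E) (le C D E).
Proof.
move=> Cc Dc Ec; apply: (iffP existsP) => [[[p /= /eqP sp]]|dE].
  case/and3P=> /andP[gp _] /eqP lp Dp.
  have := dist_triangle Cc Dc Ec.
  (* Cutting the geodesic at [D] bounds both distances by the lengths of the pieces; the triangle
     inequality then forces equality. *)
  case/splitPl: Dp sp gp lp => p1 p2 l1.
  rewrite size_cat gallery_cat last_cat l1 => sp /andP[g1 g2] l2.
  by have := dist_gallery g1; have := dist_gallery g2; rewrite l1 l2; lia.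
have [p [gp lp sp]] := shortest Cc Dc; have [q [gq lq sq]] := shortest Dc Ec.
have szE : size (p ++ q) == dist C E by rewrite size_cat sp sq dE.
exists (Tuple szE); rewrite /= /geodesic gallery_cat gp lp gq last_cat lp lq.
by rewrite szE eqxx -cat_cons mem_cat -{1}lp mem_last.
Qed.

(* Otherwise [done] tries to evaluate the existential over tuples. *)
#[local] Opaque gallery_le Defs.dist.

Lemma gallery_le_partial_order C : C \in ch -> partial_order_on ch (le C).
Proof.
move=> Cc; split.
- by move=> D Dc; apply/gallery_leP; rewrite ?dist_refl ?addn0.
- move=> D E Dc Ec /andP[/(gallery_leP Cc Dc Ec) h1 /(gallery_leP Cc Ec Dc) h2].
  by apply: dist_eq0 => //; lia.
move=> E D X Ec Dc Xc /(gallery_leP Cc Dc Ec) h1 /(gallery_leP Cc Ec Xc) h2.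
apply/gallery_leP => //.
have := dist_triangle Cc Dc Xc; have := dist_triangle Dc Ec Xc; lia.
Qed.

Lemma gallery_le_anti C D E : C \in ch -> D \in ch -> E \in ch ->
  le C D E -> le C E D -> D = E.
Proof.
move=> Cc Dc Ec h1 h2; have [_ anti _] := gallery_le_partial_order Cc.
by apply: anti => //; rewrite h1.
Qed.

Lemma gallery_le_trans C D E X :
    C \in ch -> D \in ch -> E \in ch -> X \in ch ->
  le C D E -> le C E X -> le C D X.
Proof.
by move=> Cc Dc Ec Xc; have [_ _ tr] := gallery_le_partial_order Cc; apply: tr.
Qed.

Lemma gallery_le_start C D D1 D2 :
    C \in ch -> D \in ch -> D1 \in ch -> D2 \in ch ->
  le C D D1 -> le C D1 D2 -> le D D1 D2.
Proof.
move=> Cc Dc D1c D2c.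
move=> /(gallery_leP Cc Dc D1c) h1 /(gallery_leP Cc D1c D2c) h2.
apply/gallery_leP => //.
have := dist_triangle Cc Dc D2c; have := dist_triangle Dc D1c D2c; lia.
Qed.

(** * Gates as least elements of stars *)

Definition gate F C D : Prop :=
  D \in star F /\ {in star F, forall E, le C D E}.

Lemma gate_propertyP :
  gate_property K <-> forall F C, F \in K -> C \in ch -> exists D, gate F C D.
Proof.
split=> h F C FK Cc.
  have [D DF hD] := h F C FK Cc; exists D; split=> [//|E EF].
  exact/(gallery_leP Cc (star_chamber DF) (star_chamber EF))/hD.
have [D [DF hD]] := h F C FK Cc; exists D => // E EF.
exact/(gallery_leP Cc (star_chamber DF) (star_chamber EF))/hD.
Qed.

(** A chamber [E] of the star is farther from [C] than the gate by exactly [dist D E], which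
    vanishes only for [E = D]. *)
Lemma gate_nearest F C D : C \in ch -> gate F C D ->
  nearest K F C =1 pred1 D.
Proof.
move=> Cc [DF hD] X; have Dc := star_chamber DF; apply/idP/eqP => [|->].
  case/andP=> XF /forall_inP/(_ _ DF) hX; have Xc := star_chamber XF.
  have /(gallery_leP Cc Dc Xc) h := hD X XF.
  by apply/esym/dist_eq0 => //; lia.
apply/andP; split=> //; apply/forall_inP => E EF.
by have /(gallery_leP Cc Dc (star_chamber EF)) -> := hD E EF; apply: leq_addr.
Qed.

Lemma gate_proj F C D : C \in ch -> gate F C D -> proj F C = D.
Proof.
move=> Cc /(gate_nearest Cc) h; rewrite /proj.
by case: pickP => [X|/(_ D)]; rewrite h /= ?eqxx // => /eqP.
Qed.

Lemma gate_self F C : C \in ch -> F \subset C -> gate F C C.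
Proof.
move=> Cc FC; split=> [|E EF]; first by rewrite in_star Cc.
by apply/(gallery_leP Cc Cc (star_chamber EF)); rewrite dist_refl.
Qed.

(** The source of (P3): the base chamber may move along a geodesic towards its gate, because (S3)
    carries the inequalities from [C] over to [X]. *)
Lemma gate_le_start F C D X : C \in ch -> X \in ch ->
  gate F C D -> le C X D -> gate F X D.
Proof.
move=> Cc Xc [DF hD] leX; split=> [//|E EF].
have Dc := star_chamber DF; have Ec := star_chamber EF.
by apply: (gallery_le_start Cc Xc Dc Ec leX); apply: hD.
Qed.

(** Distinct chambers sharing [G] meet exactly in [G]: a larger intersection would have the size of
    both chambers and so equal each of them. *)
Lemma codim1_in_adjacent G X E F : codim1 G X -> codim1 G E -> X != E ->
  F \subset X -> F \subset E -> F \subset G.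
Proof.
move=> /andP[GX /eqP cX] /andP[GE /eqP cE] XE FX FE.
suff -> : G = X :&: E by rewrite subsetI FX.
apply/eqP; rewrite eqEcard subsetI GX GE /= leqNgt; apply: contra XE => lt.
have XI : X :&: E == X by rewrite eqEcard subsetIl cX.
have EI : X :&: E == E by rewrite eqEcard subsetIr cE.
by rewrite eq_sym -{1}(eqP EI).
Qed.

(** * Consequences of the gate property *)

Section Gates.

Hypothesis gK : gate_property K.

Lemma proj_gate F C : F \in K -> C \in ch -> gate F C (proj F C).
Proof.
move=> FK Cc; have [D gD] := gate_propertyP.1 gK F C FK Cc.
by rewrite (gate_proj Cc gD).
Qed.

Lemma star_convex F D E X : D \in star F -> E \in star F -> X \in ch ->
  le D X E -> F \subset X.
Proof.
move=> DF EF Xc leXE.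
have Dc := star_chamber DF; have Ec := star_chamber EF.
have FK : F \in K.
  by move: DF; rewrite in_star => /andP[_]; apply: chamber_sub.
have [P [PF hP]] := gate_propertyP.1 gK F X FK Xc.
have Pc := star_chamber PF.
have /(gallery_leP Xc Pc Dc) dD := hP D DF.
have /(gallery_leP Xc Pc Ec) dE := hP E EF.
move/(gallery_leP Dc Xc Ec): leXE => dX.
suff -> : X = P by move: PF; rewrite in_star => /andP[].
(* Together, [dist D E = 2 * dist X P + dist D P + dist P E], so the triangle inequality leaves
   [dist X P = 0]. *)
apply: dist_eq0 => //; move: dD; rewrite (dist_sym Xc Dc) (dist_sym Pc Dc).
have := dist_triangle Dc Pc Ec; lia.
Qed.

(** This serves twice: its contrapositive is (P2), and in (S2) it provides the codimension-one
    faces. *)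
Lemma proj_neq_codim1 F C E : C \in ch -> E \in star F -> proj F C != E ->
  exists G, [/\ F \subset G, codim1 G E & proj G C != E].
Proof.
move=> Cc EF neE; have /andP[Ec FE] : (E \in ch) && (F \subset E).
  by rewrite -in_star.
have FK := chamber_sub Ec FE.
have [P [[PF hP] {}neE]] : exists P, gate F C P /\ P != E.
  by exists (proj F C); split=> //; apply: proj_gate.
have Pc := star_chamber PF; have /(gallery_leP Cc Pc Ec) dCE := hP E EF.
have [p [gp lp sp]] := shortest Pc Ec.
case/lastP: p => [|p Y] in gp lp sp.
  by rewrite -lp eqxx in neE.
rewrite last_rcons size_rcons in lp sp; rewrite {Y}lp -cats1 gallery_cat in gp.
case/andP: gp => gp /andP[Xc /= /andP[adj _]].
have := dist_gallery gp; have := dist_adjacent adj.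
(* [X] is the last chamber before [E] on a geodesic from the gate [P]. *)
move: (last P p) Xc adj => X Xc adj dXE dPX.
have leX : le P X E.
  apply/gallery_leP => //; apply/eqP.
  by rewrite eqn_leq dist_triangle //= -sp -addn1 leq_add.
have FX := star_convex PF EF Xc leX.
have dCX : dist C X < dist C E.
  by rewrite dCE -sp addnS ltnS (leq_trans (dist_triangle Cc Pc Xc)) ?leq_add2l.
have [_ _ /existsP[G /andP[GX GE]]] := and3P adj.
exists G; split=> //.
  apply: codim1_in_adjacent GX GE _ FX FE.
  by apply: contraTneq dCX => ->; rewrite ltnn.
have /andP[sGX _] := GX; have GK := chamber_sub Xc sGX.
(* If [E] were the gate of [G], then [X], also in the star of [G], could not be closer to [C]. *)
apply: contraTneq dCX => eE; have [_] := proj_gate GK Cc; rewrite eE => hG.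
have /hG/(gallery_leP Cc Ec Xc) -> : X \in star G by rewrite in_star Xc.
by rewrite -leqNgt leq_addr.
Qed.

Lemma gate_shelling C (t : rel {set V}) : C \in ch ->
  linear_extension ch (le C) t -> shelling K t.
Proof.
move=> Cc [lin ext]; split=> // E Ec /set0Pn[D0 D0E].
have [[_ anti _] _] := lin.
have earlierP D : reflect [/\ D \in ch, D != E & t D E] (D \in earlier K t E).
  by rewrite [X in reflect _ X]inE; apply: and3P.
(* The shelling condition, face by face. The earlier chamber containing [G] is [proj G C], which is
   below [E] for [<=_C] and hence for [t]. *)
have cross F D : D \in earlier K t E -> F \subset D -> F \subset E ->
    exists G, [/\ F \subset G, codim1 G E &
                  exists2 X, X \in earlier K t E & G \subset X].
  move=> /earlierP[Dc DE tDE] FD FE; have FK := chamber_sub Ec FE.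
  have EF : E \in star F by rewrite in_star Ec.
  (* Otherwise [E] is the gate of [F], so [E <=_C D] and [t E D], against [t D E]. *)
  have neE : proj F C != E.
    apply: contraNneq DE => eE; have [_ hF] := proj_gate FK Cc.
    have tED : t E D by rewrite ext // -eE hF // in_star Dc.
    by apply/eqP/anti; rewrite ?tDE.
  have [G [FG GE neG]] := proj_neq_codim1 Cc EF neE.
  have sGE : G \subset E by case/andP: GE.
  have [PG hG] := proj_gate (chamber_sub Ec sGE) Cc.
  exists G; split=> //; exists (proj G C); last first.
    by move: PG; rewrite in_star => /andP[].
  apply/earlierP; split=> //; first exact: star_chamber PG.
  by apply: ext; rewrite ?(star_chamber PG) ?hG // in_star Ec.
exists [set G | codim1 G E && [exists X in earlier K t E, G \subset X]]; split.
(* Applied to the empty face, [cross] shows that the family is nonempty. *)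
- have [G [_ GE [X Xe GX]]] := cross _ _ D0E (sub0set _) (sub0set _).
  by apply/set0Pn; exists G; rewrite inE GE; apply/exists_inP; exists X.
- by move=> G; rewrite inE => /andP[].
apply/setP => F; rewrite inE powersetE; apply/andP/bigcupP.
  case=> FE /bigcupP[D De]; rewrite powersetE => FD.
  have [G [FG GE [X Xe GX]]] := cross _ _ De FD FE.
  exists G; rewrite ?powersetE // inE GE; apply/exists_inP.
  by exists X.
case=> G; rewrite inE powersetE => /andP[/andP[GE _] /exists_inP[X Xe GX]] FG.
split; first exact: subset_trans GE.
by apply/bigcupP; exists X; rewrite // powersetE (subset_trans FG).
Qed.

Lemma gate_shelling_axioms : shelling_axioms K le.
Proof.
split=> [C F Cc FK|C t|]; [|exact: gate_shelling|exact: gallery_le_start].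
have [PF hP] := proj_gate FK Cc; exists (proj F C) => [|F0]; last first.
  by apply: gate_proj => //; apply: gate_self; rewrite // F0 sub0set.
have Pc := star_chamber PF; split=> [|E [EF minE]].
  split=> // E EF lEP; apply: (gallery_le_anti Cc) => //; last exact: hP.
  exact: star_chamber EF.
by apply: minE => //; apply: hP.
Qed.

Lemma gate_projection_axioms : projection_axioms K proj.
Proof.
split.
- move=> F C _ FK Cc _ <-.
  by have [] := proj_gate FK Cc; rewrite in_star => /andP[].
- by move=> F C FK Cc FC; apply: gate_proj => //; apply: gate_self.
- move=> F G C D FK GK Cc Dc eD FG GD; apply: gate_proj => //.
  have [_ hF] := proj_gate FK Cc; split=> [|E]; first by rewrite in_star Dc.
  rewrite in_star -eD => /andP[Ec GE].
  by apply: hF; rewrite in_star Ec (subset_trans FG).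
- move=> F C D FK Cc Dc FD hG; apply/eqP/negPn/negP => neD.
  have DF : D \in star F by rewrite in_star Dc.
  have [G [FG GD]] := proj_neq_codim1 Cc DF neD.
  by rewrite hG ?eqxx.
move=> F C D C1 s FK Cc Dc eD /andP[/= /andP[C1c sc] wg] lD.
apply: gate_proj => //; apply: (gate_le_start Cc) => //.
  by rewrite -eD; apply: proj_gate.
(* A weak gallery ascends in [<=_C]: each chamber is the gate of a face that the next one
   contains. *)
elim: s C1 C1c sc wg lD => [|Y s IH] X Xc /=.
  by move=> _ _ ->; have [refl _ _] := gallery_le_partial_order Cc; apply: refl.
case/andP=> Yc sc /andP[/exists_inP[G GK /and3P[/eqP eX _ GY]] wg] lD.
apply: (gallery_le_trans Cc Xc Yc Dc); last exact: IH.
by rewrite -eX; apply: (proj_gate GK Cc).2; rewrite in_star Yc.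
Qed.

Lemma gate_nearest_projection : nearest_projection K.
Proof.
split=> [F C FK Cc|]; last exact: gate_projection_axioms.
have /(gate_nearest Cc) h := proj_gate FK Cc.
exists (proj F C); split=> [|D]; first by rewrite h /=.
by rewrite h => /eqP.
Qed.

(** Everything rests on [restrP]: the interval from [R_C(D)] to [D] is the fibre over [D] of the map
    sending [F] to [FC]. *)
Lemma gate_restriction_axioms : restriction_axioms K (restriction K).
Proof.
have [_ P1ii P1iii P2 P3] := gate_projection_axioms.
have restrP C D F : C \in ch -> D \in ch -> F \subset D ->
    restriction K C D \subset F <-> proj F C = D.
  move=> Cc Dc FD; have FK := chamber_sub Dc FD; split=> [RF|eD].
    (* A codimension-one face above [F] is [D :\ v] with [v] outside [F], hence outside [R_C(D)]. *)
    apply: P2 => // G FG /andP[GD /eqP cD].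
    have /properP[_ [v vD vG]] : G \proper D by rewrite properEcard GD cD /=.
    have eG : G = D :\ v.
      apply/eqP; rewrite eqEcard subsetD1 GD vG /=.
      by move: cD; rewrite (cardsD1 v D) vD add1n => -[->].
    apply/eqP; rewrite eG; apply: contraNT vG => h.
    by apply: (subsetP FG); apply: (subsetP RF); rewrite inE vD.
  apply/subsetP => v; rewrite inE => /andP[vD]; apply: contraNT => vF.
  apply/eqP; apply: (P1iii F) => //; first exact: chamber_sub (subD1set D v).
    by rewrite subsetD1 FD.
  exact: subD1set.
have restr_sub C D : restriction K C D \subset D.
  by apply/subsetP => v; rewrite inE => /andP[].
have interval C D F : C \in ch -> D \in ch ->
    F \in [set G : {set V} | (restriction K C D \subset G) && (G \subset D)] ->
    F \subset D /\ proj F C = D.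
  by move=> Cc Dc; rewrite inE => /andP[RF FD]; split=> //; apply/restrP.
split=> //.
- move=> C Cc; apply/eqP; rewrite -subset0; apply/restrP; rewrite ?sub0set //.
  by apply: P1ii; rewrite ?set0_face ?sub0set.
- move=> C Cc; apply/setP => F; apply/idP/bigcupP => [FK|[D Dc]]; last first.
    by case/(interval _ _ _ Cc Dc) => FD _; apply: chamber_sub FD.
  have [PF _] := proj_gate FK Cc.
  exists (proj F C); first exact: star_chamber PF.
  move: PF; rewrite in_star => /andP[Pc FP]; rewrite inE FP andbT.
  exact/restrP.
- move=> C D E Cc Dc Ec DE; rewrite -setI_eq0; apply: contraR DE => /set0Pn[F].
  case/setIP=> /(interval _ _ _ Cc Dc)[_ <-] /(interval _ _ _ Cc Ec)[_ ->].
  exact: eqxx.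
move=> C D C1 s Cc /andP[/= C1c sc] hs lD; split=> //.
have Dc : D \in ch.
  by rewrite -lD; move: (mem_last C1 s); rewrite inE => /predU1P[->|/(allP sc)].
have RK : restriction K C D \in K := chamber_sub Dc (restr_sub C D).
have eR X : X \in ch -> proj (restriction K C X) C = X.
  by move=> Xc; apply/restrP.
(* For (R3), the faces [R_C(C_i)] make the sequence a weak [C]-gallery, and (P3) is applied to
   [R_C(D)]. *)
apply/(restrP C1 D) => //; apply: (P3 _ C D C1 s) => //; first exact: eR.
apply/andP; split; first exact/andP.
elim: s C1 C1c sc hs {lD} => //= Y s IH X Xc /andP[Yc sc] /andP[RY hs].
apply/andP; split; last exact: IH.
apply/exists_inP; exists (restriction K C X); first exact: chamber_sub RY.
by rewrite eR // eqxx restr_sub.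
Qed.

End Gates.

(** * Recovering gates from the shelling and projection axioms *)

(* A chamber of the star nearest to [C] among those below [E] is minimal, hence
   is [D]: a unique minimal element of a finite order is least. *)
Lemma shelling_axioms_gate : shelling_axioms K le -> gate_property K.
Proof.
move=> [S1 _ _]; apply/gate_propertyP => F C FK Cc.
have [D [[DF _] uD] _] := S1 C F Cc FK; exists D; split=> // E EF.
have Ec := star_chamber EF.
have refl X : X \in ch -> le C X X.
  by case: (gallery_le_partial_order Cc) => refl _ _ /refl.
case: (@arg_minnP _ E (fun X => (X \in star F) && le C X E) (dist C))
    => [|M /andP[MF leME] minM]; first by rewrite EF refl.
have Mc := star_chamber MF.
suff <- : M = D by [].
apply/esym/uD; split=> // X XF leXM; have Xc := star_chamber XF.
have leXE : le C X E by apply: (gallery_le_trans Cc Xc Mc).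
have := minM X; rewrite XF leXE => /(_ isT).
have /(gallery_leP Cc Xc Mc) -> := leXM.
by rewrite -leq_subRL // subnn leqn0 => /eqP; apply: dist_eq0.
Qed.

Lemma nearest_projection_gate : nearest_projection K -> gate_property K.
Proof.
move=> [ex_uniq [_ _ _ P2 _]]; apply/gate_propertyP => F C FK Cc.
have near F' : F' \in K ->
    nearest K F' C (proj F' C) /\
    forall X, nearest K F' C X -> X = proj F' C.
  move=> F'K; have [D [nD uD]] := ex_uniq F' C F'K Cc.
  have eD : proj F' C = D.
    by rewrite /proj; case: pickP => [X /uD //|/(_ D)]; rewrite nD.
  by rewrite eD; split=> // X /uD.
have [D eD] : exists D, proj F C = D by exists (proj F C).
have [/andP[DF _] _] := near F FK; rewrite eD in DF.
have Dc := star_chamber DF; exists D; split=> // E.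
have [n] := ubnP (dist C E); elim: n E => // n IH E leEn EF.
have Ec := star_chamber EF; have FE : F \subset E.
  by move: EF; rewrite in_star => /andP[].
have [->|neE] := eqVneq E D.
  by case: (gallery_le_partial_order Cc) => refl _ _; apply: refl.
have [G /and3P[FG GE neG]] :
    exists G, [&& F \subset G, codim1 G E & proj G C != E].
  apply/existsP; apply: contra_neqT neE => /existsPn h.
  rewrite -eD; apply/esym/P2 => // G FG GE; apply/eqP.
  by have := h G; rewrite FG GE negbK.
have [sGE _] := andP GE; have GK := chamber_sub Ec sGE.
have [/andP[XG /forall_inP minX] uX] := near G GK.
move: (proj G C) neG XG minX uX => X neG XG minX uX; have Xc := star_chamber XG.
have EG : E \in star G by rewrite in_star Ec.
(* Purity gives [G] codimension one in [X] as well, so [X] and [E] are adjacent. *)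
have GX : codim1 G X.
  case: hK => _ pureK _; case/andP: GE => _ cE.
  rewrite /codim1 (pureK X E) // cE andbT.
  by move: XG; rewrite in_star => /andP[].
have dXE : dist X E <= 1.
  apply: dist_adjacent; apply/and3P; split=> //.
  by apply/existsP; exists G; rewrite GX.
(* Otherwise [E] would also be nearest in the star of [G], and uniqueness would give [E = X]. *)
have ltXE : dist C X < dist C E.
  rewrite ltnNge; apply: contra_neqN neG => leE; apply/esym/uX.
  apply/andP; split=> //; apply/forall_inP => Y YG.
  exact: leq_trans leE (minX Y YG).
have leXE : le C X E.
  apply/gallery_leP => //; apply/eqP; rewrite eqn_leq dist_triangle //=.
  by rewrite (leq_trans _ ltXE) // -addn1 leq_add2l.
apply: (gallery_le_trans Cc Dc Xc Ec) leXE.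
apply: IH; first exact: leq_trans ltXE leEn.
by rewrite in_star Xc (subset_trans FG) //; case/andP: GX.
Qed.

End GateProperty.

Theorem theorem6p2 (V : finType) (K : {set {set V}})
    (hK : chamber_complex K) :
  [/\ forall C : {set V}, C \in chambers K ->
        partial_order_on (chambers K) (gallery_le K C),
      [<-> gate_property K;
           shelling_axioms K (gallery_le K);
           nearest_projection K] &
      gate_property K -> restriction_axioms K (restriction K)].
Proof.
split; first exact: gallery_le_partial_order.
  tfae.
  - exact: gate_shelling_axioms.
  - by move=> /(shelling_axioms_gate hK); apply: gate_nearest_projection.
  - exact: nearest_projection_gate.
exact: gate_restriction_axioms.
Qed.
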